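(* Let $d\ge1$ and $1\le k\le 2d$ be integers. Then $\theta^{\rm D}(k,d)>0$ holds if $d\ge4$ and $k\ge4$, or if $d\ge5$ and $k=3$.
   Context: The directed $k$-neighbor graph ($k$-DnG) on $\mathbb{Z}^d$ is the random directed graph obtained by letting each vertex $x\in\mathbb{Z}^d$, independently of all other vertices, choose a uniformly random subset of exactly $k$ of its $2d$ nearest neighbors (in $\ell_1$-distance), and placing a directed edge from $x$ to each chosen neighbor. We write $\theta^{\rm D}(k,d)=\mathbb{P}(o\rightsquigarrow\infty \text{ in the $k$-DnG on }\mathbb{Z}^d)$, where $o$ is the origin and $o\rightsquigarrow\infty$ is the event that there is an infinite self-avoiding directed path along edges of the $k$-DnG starting at $o$. *)

(* Defs.v *)
From HB Require Import structures.
From mathcomp Require Import all_boot all_order all_algebra.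
From mathcomp Require Import all_classical all_reals all_analysis.
Set Implicit Arguments. Unset Strict Implicit. Unset Printing Implicit Defensive.
Import Order.TTheory GRing.Theory Num.Theory.
Local Open Scope classical_set_scope.
Local Open Scope ring_scope.

Definition zpt (dim : nat) := {ffun 'I_dim -> int}.

Definition origin (dim : nat) : zpt dim := [ffun _ => 0].

(* The 2*dim nearest neighbours of x (in l1 distance) are indexed by
   i : 'I_(2*dim): i < dim gives x + e_i, and i >= dim gives x - e_(i-dim). *)
Definition nbr (dim : nat) (x : zpt dim) (i : 'I_(2 * dim)) : zpt dim :=
  [ffun j : 'I_dim => x j +
     (if (val i < dim)%N then (nat_of_bool (val j == val i))%:Z
      else - (nat_of_bool (val j == (val i - dim)%N))%:Z)].

(* omega x t is the set of (indices of) neighbours chosen by vertex x in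
   outcome t.  kDnG_model P omega k says that the family (omega x)_x is a
   family of mutually independent random variables, each uniformly
   distributed on the k-element subsets of the 2*dim neighbours. *)
Definition kDnG_model (dim : nat) (R : realType) (d : measure_display)
    (T : measurableType d) (P : probability T R)
    (omega : zpt dim -> T -> {set 'I_(2 * dim)}) (k : nat) : Prop :=
  [/\ (forall x S, measurable (omega x @^-1` [set S])),
      (forall x S, P (omega x @^-1` [set S]) =
         (if #|S| == k then (('C(2 * dim, k))%:R^-1)%:E else 0%E)) &
      (forall (xs : seq (zpt dim)) (Sf : zpt dim -> {set 'I_(2 * dim)}),
         uniq xs ->
         P (\big[setI/setT]_(x <- xs) (omega x @^-1` [set Sf x])) =
         (\prod_(x <- xs) P (omega x @^-1` [set Sf x]))%E)].

Definition escapes (dim : nat) (T : Type)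
    (omega : zpt dim -> T -> {set 'I_(2 * dim)}) : set T :=
  [set t | exists p : nat -> zpt dim,
      [/\ injective p, p 0%N = origin dim &
          forall n, exists2 i, i \in omega (p n) t & p n.+1 = nbr (p n) i]].

(* Main.v *)
Require Import Defs.
From HB Require Import structures.
From mathcomp Require Import all_boot all_order all_algebra.
From mathcomp Require Import all_classical all_reals all_analysis.
From mathcomp Require Import zify ring lra.
Set Implicit Arguments. Unset Strict Implicit. Unset Printing Implicit Defensive.
Import Order.TTheory GRing.Theory Num.Theory.
Local Open Scope classical_set_scope.
Local Open Scope ring_scope.

(** Only paths along the positive coordinate directions are used.  With
    [p = k/(2d)], the number [N] of open such paths of length [n] from the origin
    has mean [(p d)^n].  Two paths can share a vertex only at equal times, and
    two distinct edges out of a vertex are negatively correlated, so the second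
    moment is dominated by the mean of [p^-1] to the number of common edges of
    two independent uniform upward walks.  Expanding at the first marked common
    edge bounds it by [M (p d)^(2n)] as soon as [(2/k - 1/d) G < 1], where [G]
    bounds the expected number of meetings.  The meeting probability at time [n]
    is at most the largest multinomial probability, which gives
    [(1/2 - 1/d) G < 1] for [d >= 4] and [(2/3 - 1/d) G < 1] for [d >= 5].  The
    second moment method yields [P (N > 0) >= 1/M] for every [n], and Konig's
    lemma passes to the limit; it also shows that [escapes omega] is measurable. *)

(** * Words over a finite alphabet and multinomial counts *)

Fixpoint words (T : finType) (n : nat) : seq (seq T) :=
  if n is m.+1 then [seq j :: w | j <- enum T, w <- words T m] else [:: [::]].

Lemma big_words (R : nmodType) (T : finType) n (F : seq T -> R) :
  \sum_(w <- words T n.+1) F w = \sum_j \sum_(w <- words T n) F (j :: w).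
Proof. by rewrite /= big_allpairs_dep big_enum. Qed.

Lemma size_word (T : finType) n w : w \in words T n -> size w = n.
Proof.
elim: n w => [|n IHn] w /=; first by rewrite inE => /eqP ->.
by case/allpairsP=> -[j v] /= [_ /IHn <- ->].
Qed.

Section Counting.
Variable d : nat.

Definition has_counts (m : 'I_d -> nat) (w : seq 'I_d) :=
  [forall i, count_mem i w == m i].

(** The multinomial coefficient of [m] when the entries of [m] sum to [n], and 0 otherwise. *)
Definition nwords (n : nat) (m : 'I_d -> nat) : nat :=
  (\sum_(w <- words 'I_d n) has_counts m w)%N.

Definition decr (j : 'I_d) (m : 'I_d -> nat) : 'I_d -> nat :=
  fun i => (m i - (i == j))%N.

Lemma has_countsP m w :
  reflect (forall i, count_mem i w = m i) (has_counts m w).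
Proof. by apply: (iffP fintype.forallP) => H i; apply/eqP; rewrite H. Qed.

Lemma has_counts_cons m j w :
  has_counts m (j :: w) = (0 < m j)%N && has_counts (decr j m) w.
Proof.
apply/has_countsP/andP=> [H|[mj /has_countsP H] i].
  split; first by rewrite -(H j) /= eqxx.
  by apply/has_countsP => i; rewrite /decr -(H i) /= (eq_sym i j) addKn.
rewrite /= H /decr eq_sym; case: (eqVneq j i) => [<-|_] /=; last by rewrite subn0.
by rewrite subn1 add1n prednK.
Qed.

Lemma nwordsS n m :
  nwords n.+1 m = (\sum_(j | (0 < m j)%N) nwords n (decr j m))%N.
Proof.
rewrite /nwords (big_words (R := nat)) [RHS]big_mkcond /=; apply: eq_bigr => j _.
case: ifP => mj.
  by apply: eq_bigr => w _; rewrite has_counts_cons mj.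
by rewrite big1 // => w _; rewrite has_counts_cons mj.
Qed.

Lemma sum_decr m j : (0 < m j)%N ->
  (\sum_i m i = (\sum_i decr j m i).+1)%N.
Proof.
move=> mj; rewrite (bigD1 j) //= [in RHS](bigD1 j) //= /decr eqxx subn1.
rewrite -addSn prednK //; congr addn; apply: eq_bigr => i /negPf ->.
by rewrite subn0.
Qed.

Lemma prod_fact_decr m j : (0 < m j)%N ->
  (\prod_i (m i)`! = m j * \prod_i (decr j m i)`!)%N.
Proof.
move=> mj; rewrite (bigD1 j) //= [in RHS](bigD1 j) //= /decr eqxx subn1.
rewrite mulnA; congr muln; first by rewrite -[in LHS](prednK mj) factS prednK.
by apply: eq_bigr => i /negPf ->; rewrite subn0.
Qed.

Lemma nwords_eq0 n m : \sum_i m i != n :> nat -> nwords n m = 0%N.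
Proof.
elim: n m => [|n IHn] m mn.
  rewrite /nwords /= big_seq1; case: has_countsP => //= H.
  by case/eqP: mn; apply: big1 => i _; rewrite -H.
rewrite nwordsS big1 // => j mj; apply: IHn.
by apply: contraNneq mn => e; rewrite (sum_decr mj) e.
Qed.

(** Induction on the first letter: with [n + 1] the sum of the [m j], the term of [j] is at most
    [m j * n!]. The inequality also covers those [m] with the wrong sum. *)
Lemma nwords_fact n m : (nwords n m * \prod_i (m i)`! <= n`!)%N.
Proof.
elim: n m => [|n IHn] m.
  rewrite /nwords /= big_seq1; case: has_countsP => //= H.
  by rewrite mul1n big1 // => i _; rewrite -H.
have [mn|/nwords_eq0 -> //] := eqVneq (\sum_i m i)%N n.+1.
rewrite nwordsS big_distrl /= factS -mn big_distrl /= big_mkcond /=.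
apply: leq_sum => j _; case: ifP => // mj.
by rewrite (prod_fact_decr mj) mulnCA leq_mul2l IHn orbT.
Qed.

(** The Poisson weights [q^m / m!] are largest at [m = q]: the ratio of consecutive weights is
    [q / (m + 1)]. *)
Lemma fact_expn_le q m : (q`! * q ^ m <= m`! * q ^ q)%N.
Proof.
have [mq|/ltnW qm] := leqP m q.
  have H r : (r <= q -> q`! <= (q - r)`! * q ^ r)%N.
    elim: r => [|r IHr] rq; first by rewrite subn0 muln1.
    apply: leq_trans (IHr (ltnW rq)) _.
    have -> : ((q - r)`! = (q - r) * (q - r.+1)`!)%N.
      by rewrite subnS -[in LHS](@prednK (q - r)) ?subn_gt0 // factS prednK ?subn_gt0.
    by rewrite expnS -mulnA [in leqRHS]mulnCA leq_mul // leq_subr.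
  have -> : (q ^ q = q ^ (q - m) * q ^ m)%N by rewrite -expnD subnK.
  rewrite mulnA leq_mul2r; apply/orP; right.
  by have := H _ (leq_subr m q); rewrite subKn.
have H r : (q`! * q ^ r <= (r + q)`!)%N.
  elim: r => [|r IHr]; first by rewrite muln1.
  by rewrite addSn factS expnS mulnCA leq_mul // ltnW // ltnS leq_addl.
have -> : (q ^ m = q ^ (m - q) * q ^ q)%N by rewrite -expnD subnK.
by rewrite mulnA leq_mul2r; apply/orP; right; have := H (m - q)%N; rewrite subnK.
Qed.

(** Balanced counts minimise the product of factorials: in the product of [fact_expn_le] over all
    letters, the powers of [q] on both sides have the same exponent and cancel. *)
Lemma prod_fact_ge q (m : 'I_d -> nat) : (\sum_i m i = q * d -> q`! ^ d <= \prod_i (m i)`!)%N.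
Proof.
have [->|q0] := posnP q.
  by move=> _; rewrite fact0 exp1n prodn_gt0 => // i; rewrite fact_gt0.
move=> mq; have : (\prod_(i < d) (q`! * q ^ m i) <= \prod_(i < d) ((m i)`! * q ^ q))%N.
  by apply: leq_prod => i _; apply: fact_expn_le.
rewrite !big_split /= -expn_sum mq !prod_nat_const card_ord -expnM.
by rewrite leq_pmul2r // expn_gt0 q0.
Qed.

Lemma nwords_mul_fact q m : (nwords (q * d) m * q`! ^ d <= (q * d)`!)%N.
Proof.
have [mn|/nwords_eq0 -> //] := eqVneq (\sum_i m i)%N (q * d)%N.
by apply: leq_trans (nwords_fact _ m); rewrite leq_mul2l prod_fact_ge ?orbT.
Qed.

Lemma nwords_le_fact n m : (nwords n m <= n`!)%N.
Proof.
apply: leq_trans (nwords_fact n m); apply: leq_pmulr.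
by apply: prodn_gt0 => // i; rewrite fact_gt0.
Qed.

(** The first [r] letters are free; each choice leaves a counting problem of length [n]. *)
Lemma nwords_addn_le r n m c :
  (forall m', nwords n m' <= c)%N -> (nwords (r + n) m <= d ^ r * c)%N.
Proof.
move=> Hc; elim: r m => [|r IHr] m; first by rewrite mul1n.
rewrite addSn nwordsS expnS -mulnA.
apply: leq_trans (_ : \sum_(j < d) d ^ r * c <= _)%N; last first.
  by rewrite sum_nat_const card_ord.
by rewrite big_mkcond /=; apply: leq_sum => j _; case: ifP.
Qed.
End Counting.

(** * Bounds on the largest multinomial probability and on their sum *)

Section Bounds.
Variables (R : realType) (d : nat).
Implicit Types i n q : nat.

Definition head n : R := n`!%:R / d%:R ^+ n.

Definition block q : R := (q * d)`!%:R / (q`!%:R ^+ d * d%:R ^+ (q * d)).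

(** For [n < d] the most likely counts come from distinct letters. For larger [n] only the last
    [d * (n %/ d)] letters are used, with balanced counts, so the bound is constant on blocks of [d]
    consecutive times. *)
Definition maxprob n : R := if (n < d)%N then head n else block (n %/ d).

Hypothesis d_gt0 : (0 < d)%N.

Let dR0 : d%:R != 0 :> R.
Proof. by rewrite pnatr_eq0 -lt0n. Qed.

Lemma head_ge0 n : 0 <= head n.
Proof. by rewrite divr_ge0 // exprn_ge0. Qed.

Lemma block_ge0 q : 0 <= block q.
Proof. by rewrite divr_ge0 // mulr_ge0 // exprn_ge0. Qed.

Lemma maxprob_ge0 n : 0 <= maxprob n.
Proof. by rewrite /maxprob; case: ifP => _; rewrite (head_ge0, block_ge0). Qed.

Lemma nwords_le_maxprob n (m : 'I_d -> nat) :
  (nwords n m)%:R <= d%:R ^+ n * maxprob n.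
Proof.
rewrite /maxprob; case: ifP => nd.
  by rewrite /head mulrCA divff ?mulr1 ?expf_neq0 // ler_nat nwords_le_fact.
set q := (n %/ d)%N; set r := (n %% d)%N.
have -> : n = (r + q * d)%N by rewrite addnC -divn_eq.
have H (m' : 'I_d -> nat) : (nwords (q * d) m' <= (q * d)`! %/ q`! ^ d)%N.
  by rewrite leq_divRL ?expn_gt0 ?fact_gt0 // nwords_mul_fact.
have := @nwords_addn_le d r (q * d) m _ H; rewrite -(ler_nat R) => /le_trans; apply.
rewrite natrM exprD -mulrA natrX ler_wpM2l ?exprn_ge0 //.
rewrite /block invfM mulrCA [X in _ * X]mulrCA divff ?expf_neq0 // mulr1.
rewrite -natrX ler_pdivlMr ?ltr0n ?expn_gt0 ?fact_gt0 // -natrM ler_nat.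
exact: leq_trunc_div.
Qed.

(** The range is enlarged to [n + 1] full blocks of length [d]; the first one gives the [head]
    terms, and each later one repeats its [block] value [d] times. *)
Lemma sum_maxprob_le n :
  \sum_(i < n) maxprob i <=
  \sum_(i < d) head i + d%:R * \sum_(1 <= q < n.+1) block q.
Proof.
have H Q : \sum_(0 <= i < Q.+1 * d) maxprob i =
    \sum_(i < d) head i + d%:R * \sum_(1 <= q < Q.+1) block q.
  elim: Q => [|Q IHQ].
    rewrite mul1n [X in _ + _ * X]big_geq // mulr0 addr0 big_mkord.
    by apply: eq_bigr => i _; rewrite /maxprob ltn_ord.
  rewrite mulSn addnC (@big_cat_nat _ _ _ (Q.+1 * d)) ?leq_addr //= IHQ.
  rewrite -addrA; congr (_ + _); rewrite [in RHS]big_nat_recr //= mulrDr.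
  congr (_ + _); rewrite -{1}[(Q.+1 * d)%N]add0n big_addn addnC addnK.
  rewrite (eq_big_nat _ _ (F2 := fun=> block Q.+1)); last first.
    move=> i /andP[_ id]; rewrite /maxprob [(i + _)%N]addnC divnMDl // divn_small // addn0.
    by rewrite ifF //; apply/negbTE; rewrite -leqNgt mulSn -addnA leq_addr.
  by rewrite big_const_nat subn0 iter_addr_0 mulr_natl.
rewrite -H -(big_mkord xpredT) [in leRHS](@big_cat_nat _ _ _ n) //=; last first.
  by rewrite mulSn; apply: leq_trans (leq_pmulr _ d_gt0) (leq_addl _ _).
by rewrite lerDl sumr_ge0 // => i _; apply: maxprob_ge0.
Qed.

Lemma headS n : head n.+1 = head n * (n.+1%:R / d%:R).
Proof. by rewrite /head factS natrM exprS invfM; ring. Qed.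

Lemma head_le m n : (m <= n <= d)%N -> head n <= head m.
Proof.
case/andP; elim: n => [|n IHn]; first by rewrite leqn0 => /eqP ->.
rewrite leq_eqVlt => /predU1P[-> //|mn nd].
apply: le_trans (IHn mn (ltnW nd)); rewrite headS ler_piMr ?head_ge0 //.
by rewrite ler_pdivrMr ?ltr0n // mul1r ler_nat.
Qed.

Lemma block1 : block 1 = head d.
Proof. by rewrite /block /head !mul1n expr1n mul1r. Qed.

End Bounds.

(** * Decay of the balanced multinomial probabilities *)

Section BlockDecay.
Variables (R : realType) (e : nat).
Let d := e.+1.
Local Notation blk := (block R d).

Lemma fact_addn m n : ((m + n)`! = m`! * \prod_(i < n) (m + i.+1))%N.
Proof.
elim: n => [|n IHn]; first by rewrite big_ord0 addn0 muln1.
by rewrite big_ord_recr /= mulnA -IHn addnS factS mulnC.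
Qed.

Lemma blockS q : blk q.+1 =
  blk q * \prod_(i < e) ((q * d + i.+1)%:R / (q.+1 * d)%:R).
Proof.
have nz a : a.+1%:R != 0 :> R by rewrite pnatr_eq0.
have fz a : (a`!)%:R != 0 :> R by rewrite pnatr_eq0 -lt0n fact_gt0.
(* The factor [i = e] equals 1; restoring it completes the quotient of [((q + 1) d)!] by
   [(q d)!]. *)
have -> : \prod_(i < e) ((q * d + i.+1)%:R / (q.+1 * d)%:R) =
    \prod_(i < d) ((q * d + i.+1)%:R / (q.+1 * d)%:R) :> R.
  rewrite big_ord_recr /= -/d addnC -mulSn divff ?mulr1 //.
  by rewrite pnatr_eq0 muln_eq0.
rewrite big_split /= prodr_const card_ord /block.
rewrite mulSn addnC fact_addn natrM -natr_prod factS exprD -mulSnr.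
rewrite !natrM exprVn !exprMn.
have hd := expf_neq0 d (nz e); have hf := expf_neq0 d (fz q).
have hq := expf_neq0 d (nz q); have hqd := expf_neq0 (q * d) (nz e).
by field; rewrite ?hd ?hf ?hq ?hqd.
Qed.

(* Pairing the factors [i] and [e - 1 - i] and applying AM-GM. *)
Lemma block_ratio q : blk q.+1 <= blk q * ((2 * q + 1)%:R / (2 * q + 2)%:R) ^+ e.
Proof.
rewrite blockS ler_wpM2l ?block_ge0 //.
set r := _ / _; set a := fun i : 'I_e => (q * d + i.+1)%:R / (q.+1 * d)%:R : R.
have a0 i : 0 <= a i by rewrite divr_ge0.
have r0 : 0 <= r by rewrite divr_ge0.
rewrite -(ler_pXn2r (n := 2)) ?nnegrE ?exprn_ge0 ?prodr_ge0 //.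
rewrite [leRHS]exprAC [leLHS]expr2 [X in _ * X](reindex_inj rev_ord_inj) /=.
rewrite -big_split /=.
have -> : (r ^+ 2) ^+ e = \prod_(i < e) r ^+ 2 by rewrite prodr_const card_ord.
apply: ler_prod => i _; rewrite mulr_ge0 //=.
apply: le_trans (leif_AGM2 _ _) _.
suff -> : (a i + a (rev_ord i)) / 2 = r by [].
have nz b : b.+1%:R != 0 :> R by rewrite pnatr_eq0.
rewrite /a /r -mulrDl -natrD.
have -> : (q * d + i.+1 + (q * d + (rev_ord i).+1) = (2 * q + 1) * d)%N.
  by rewrite /= /d; have := ltn_ord i; nia.
have -> : (2 * q + 2 = 2 * q.+1)%N by lia.
rewrite !natrM; have := nz q; have : d%:R != 0 :> R by apply: nz.
move: (q.+1%:R : R) (d%:R : R) ((2 * q + 1)%:R : R) => x y z y0 x0.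
by field; rewrite x0 y0.
Qed.

(* The potential [(q + 1) * block q] decreases by at least [c * block q]. *)
Lemma sum_block_le (c : R) n :
  (forall q, (0 < q)%N ->
    (q + 2)%:R * ((2 * q + 1)%:R / (2 * q + 2)%:R) ^+ e + c <= q.+1%:R) ->
  c * \sum_(1 <= q < n.+1) blk q <= 2 * blk 1.
Proof.
move=> H; apply: le_trans (_ : 2 * blk 1 - (n + 2)%:R * blk n.+1 <= _); last first.
  by rewrite gerBl mulr_ge0 // block_ge0.
elim: n => [|n IHn]; first by rewrite big_geq // mulr0 subrr.
rewrite big_nat_recr //= mulrDr.
have := block_ratio n.+1; have := H n.+1 isT.
set r := _ ^+ e; have := block_ge0 R d n.+1.
set u := blk n.+1; set v := blk n.+2 => u0 hr hv.
have : (n.+1 + 2)%:R * v <= (n.+1 + 2)%:R * (u * r) by rewrite ler_wpM2l.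
have : u * ((n.+1 + 2)%:R * r + c) <= u * n.+2%:R by rewrite ler_wpM2l.
move: IHn; rewrite -/u !addn2; lra.
Qed.

End BlockDecay.

(** * Numerical estimates for the expected number of meetings *)

Lemma ratio3_le (R : realType) q : (0 < q)%N ->
  (q + 2)%:R * ((2 * q + 1)%:R / (2 * q + 2)%:R) ^+ 3 + 1 / 2 <= q.+1%:R :> R.
Proof.
move=> q0; have : 1 <= q%:R :> R by rewrite ler1n.
have -> : (2 * q + 1)%:R = 2 * q%:R + 1 :> R by rewrite natrD natrM.
have -> : (2 * q + 2)%:R = 2 * q%:R + 2 :> R by rewrite natrD natrM.
rewrite natrD -natr1; set x : R := q%:R => x1.
have x2 : 0 < 2 * x + 2 by lra.
rewrite expr_div_n mulrA -lerBrDr ler_pdivrMr ?exprn_gt0 // -subr_ge0.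
rewrite [leRHS](_ : _ = (3 * x + 2) * (2 * x + 1)); last by field.
by rewrite mulr_ge0 //; lra.
Qed.

(** The decrement for [e = 4], that is [d = 5], can be taken to be 1, against [1 / 2] for [e = 3] in
    [ratio3_le]. *)
Lemma ratio4_le (R : realType) q : (0 < q)%N ->
  (q + 2)%:R * ((2 * q + 1)%:R / (2 * q + 2)%:R) ^+ 4 + 1 <= q.+1%:R :> R.
Proof.
move=> q0; have : 1 <= q%:R :> R by rewrite ler1n.
have -> : (2 * q + 1)%:R = 2 * q%:R + 1 :> R by rewrite natrD natrM.
have -> : (2 * q + 2)%:R = 2 * q%:R + 2 :> R by rewrite natrD natrM.
rewrite natrD -natr1; set x : R := q%:R => x1.
have x2 : 0 < 2 * x + 2 by lra.
rewrite expr_div_n mulrA -lerBrDr ler_pdivrMr ?exprn_gt0 // -subr_ge0.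
rewrite [leRHS](_ : _ = 8 * x ^+ 3 + (8 * x ^+ 2 - x - 2)); last by ring.
by rewrite addr_ge0 ?mulr_ge0 ?exprn_ge0 //; nra.
Qed.

(** The terms 0, 1, 2 are exact; the other [d - 3] are at most [head 3] by monotonicity. *)
Lemma sum_head_le (R : realType) d : (3 < d)%N ->
  \sum_(i < d) head R d i <=
  1 + 1 / d%:R + 2 / d%:R ^+ 2 + (d%:R - 3) * (6 / d%:R ^+ 3).
Proof.
move=> d3; have d0 : (0 < d)%N by lia.
rewrite -(big_mkord xpredT) (@big_cat_nat _ _ _ 3) //=; last by lia.
do 3 rewrite big_nat_recr //=.
rewrite big_geq // add0r.
rewrite /head !factS fact0 expr0 expr1 !mul1n divr1; apply: lerD; first by rewrite lexx.
apply: le_trans (_ : \sum_(3 <= i < d) (6 / d%:R ^+ 3) <= _).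
  by rewrite !big_nat; apply: ler_sum => i /andP[i3 id]; apply: (head_le R d0 (m := 3)); lia.
by rewrite sumr_const_nat -[leLHS]mulr_natl natrB ?lexx // ltnW.
Qed.

Lemma sum_maxprob_bounded (R : realType) d : (3 < d)%N ->
  exists2 G : R, forall n, \sum_(i < n) maxprob R d i <= G &
    [/\ 0 <= G, (1 / 2 - 1 / d%:R) * G < 1 &
        (4 < d)%N -> (2 / 3 - 1 / d%:R) * G < 1].
Proof.
move=> d3; have d0 : (0 < d)%N by lia.
have key (c : R) n : 0 < c -> (forall q, (0 < q)%N ->
    (q + 2)%:R * ((2 * q + 1)%:R / (2 * q + 2)%:R) ^+ d.-1 + c <= q.+1%:R) ->
  \sum_(i < n) maxprob R d i <= 1 + 1 / d%:R + 2 / d%:R ^+ 2 +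
    (d%:R - 3) * (6 / d%:R ^+ 3) + d%:R * (2 / c * (24 / d%:R ^+ 4)).
  move=> c0 H; apply: le_trans (sum_maxprob_le R d0 n) _.
  apply: lerD (sum_head_le R d3) _; rewrite ler_wpM2l //.
  have := @sum_block_le R d.-1 c n H; rewrite prednK // block1 => Hb.
  (* [block 1 = head d] is at most [head 4 = 24 / d^4], which produces the last term of [key]. *)
  have := @head_le R _ d0 4 d; rewrite d3 leqnn => /(_ isT) h4.
  rewrite mulrAC ler_pdivlMr // mulrC; apply: le_trans Hb _.
  by rewrite ler_wpM2l.
have [d4|d5] : d = 4%N \/ (4 < d)%N by lia.
  eexists => [n|].
    apply: (key (1 / 2)) => [|q q0]; first by lra.
    by rewrite d4; apply: ratio3_le.
  rewrite d4; split=> //; lra.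
have v0 : 0 < d%:R^-1 :> R by rewrite invr_gt0 ltr0n.
have v5 : d%:R^-1 <= 1 / 5 :> R.
  by rewrite div1r lef_pV2 ?posrE ?ltr0n // ler_nat.
set v : R := d%:R^-1 in v0 v5.
(* The bound of [key] with [c = 1], rewritten in [v = 1 / d]. *)
exists (1 + v + 8 * v ^+ 2 + 30 * v ^+ 3) => [n|].
  apply: le_trans (key 1 n _ _) _ => [|q q0|]; first by lra.
    (* The ratio is at most 1, so its power [d - 1] is at most its fourth power. *)
    apply: le_trans (ratio4_le R q0); rewrite lerD2r ler_wpM2l //.
    apply: ler_wiXn2l; last by lia.
      by rewrite divr_ge0.
    by rewrite ler_pdivrMr ?ltr0n ?mul1r ?ler_nat //; lia.
  rewrite le_eqVlt /v; apply/orP; left; apply/eqP; field.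
  by rewrite pnatr_eq0 -lt0n.
(* Since [v <= 1 / 5], [8 v^2 + 30 v^3 <= (8/5 + 6/5) v]. *)
have G1 : 1 + v + 8 * v ^+ 2 + 30 * v ^+ 3 <= 1 + 38 / 10 * v by nra.
have G0 : 0 <= 1 + v + 8 * v ^+ 2 + 30 * v ^+ 3.
  by rewrite !addr_ge0 ?mulr_ge0 ?exprn_ge0 // ltW.
rewrite [1 / d%:R]div1r -/v.
have H : (2 / 3 - v) * (1 + v + 8 * v ^+ 2 + 30 * v ^+ 3) < 1.
  apply: le_lt_trans (_ : (2 / 3 - v) * (1 + 38 / 10 * v) < 1); last by nra.
  by rewrite ler_wpM2l //; lra.
split=> [//| |_ //]; apply: le_lt_trans H.
by rewrite ler_wpM2r //; lra.
Qed.

(** * Meetings and common edges of two upward walks *)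

Lemma big_words2 (R : nmodType) (T : finType) n (F : seq T -> seq T -> R) :
  \sum_(w <- words T n.+1) \sum_(w' <- words T n.+1) F w w' =
  \sum_j \sum_j' \sum_(w <- words T n) \sum_(w' <- words T n) F (j :: w) (j' :: w').
Proof.
rewrite big_words; apply: eq_bigr => j _; rewrite [RHS]exchange_big /=.
by apply: eq_bigr => w _; rewrite big_words.
Qed.

Lemma size_words (T : finType) n : size (words T n) = (#|T| ^ n)%N.
Proof. by elim: n => //= n IHn; rewrite size_allpairs IHn -cardE expnS. Qed.

Section Collisions.
Variables (R : realType) (d : nat).
Hypothesis d_gt0 : (0 < d)%N.

Lemma leq_double : (d <= 2 * d)%N.
Proof. by rewrite leq_pmull. Qed.

Definition up : 'I_d -> 'I_(2 * d) := widen_ord leq_double.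

Definition upstep (x : zpt d) (j : 'I_d) : zpt d := nbr x (up j).

Definition upend (x : zpt d) (w : seq 'I_d) : zpt d := foldl upstep x w.

Lemma upendE x w i : upend x w i = x i + (count_mem i w)%:Z.
Proof.
elim: w x => [|j w IHw] x; first by rewrite /= addr0.
rewrite /= -/(upend (upstep x j) w) IHw ffunE /= ltn_ord PoszD addrA.
by rewrite -(inj_eq val_inj) /= eq_sym.
Qed.

(** The probability that independent uniform upward walks from [x] and [y] are at the same vertex at
    time [n]. *)
Definition collide n (x y : zpt d) : R :=
  (\sum_(w <- words 'I_d n) \sum_(w' <- words 'I_d n) (upend x w == upend y w')%:R)
  / d%:R ^+ (2 * n).

Let dR0 : d%:R != 0 :> R.
Proof. by rewrite pnatr_eq0 -lt0n. Qed.

Lemma collide_ge0 n x y : 0 <= collide n x y.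
Proof. by rewrite divr_ge0 ?exprn_ge0 // sumr_ge0 // => w _; rewrite sumr_ge0. Qed.

Lemma collide0 x y : collide 0 x y = (x == y)%:R.
Proof. by rewrite /collide /= !big_seq1 divr1. Qed.

Lemma collideS n x y :
  d%:R ^+ 2 * collide n.+1 x y =
  \sum_j \sum_j' collide n (upstep x j) (upstep y j').
Proof.
rewrite /collide big_words2 mulnS exprD invfM mulrCA mulVKf ?expf_neq0 //.
rewrite big_distrl; apply: eq_bigr => j _ /=; rewrite big_distrl /=.
by [].
Qed.

(** Once [w] is fixed, a meeting prescribes every letter count of [w'], so at most [nwords] choices
    remain. *)
Lemma collide_le n x y : collide n x y <= maxprob R d n.
Proof.
rewrite ler_pdivrMr ?exprn_gt0 ?ltr0n //.
apply: le_trans (_ : \sum_(w <- words 'I_d n) (d%:R ^+ n * maxprob R d n) <= _); last first.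
  rewrite big_const_seq count_predT size_words card_ord iter_addr_0.
  by rewrite -[leLHS]mulr_natl natrX mulrA -exprD addnn -mul2n mulrC.
apply: ler_sum => w _; set v := upend x w.
apply: le_trans (nwords_le_maxprob R d_gt0 n (fun i => `|v i - y i|%N)).
rewrite /nwords natr_sum; apply: ler_sum => w' _; rewrite ler_nat.
case: eqP => // vw; case: has_countsP => // -[] i.
by rewrite vw upendE addrC addKr.
Qed.

Variables (p : R) (q : 'I_d -> 'I_d -> R).

(** For words of equal length this will be the probability that both paths are open: [q] is the
    joint law of two edges out of one vertex, and edges out of distinct vertices are independent. *)
Fixpoint pair_weight (x y : zpt d) (w w' : seq 'I_d) : R :=
  match w, w' with
  | j :: u, j' :: u' => (if x == y then q j j' else p ^+ 2) *
      pair_weight (upstep x j) (upstep y j') u u'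
  | _, _ => 1
  end.

Hypothesis q_ge0 : forall j j', 0 <= q j j'.
Hypothesis q_diag : forall j, q j j = p.
Hypothesis q_off : forall j j', j != j' -> q j j' <= p ^+ 2.
Hypothesis p_gt0 : 0 < p.
Hypothesis p_le1 : p <= 1.

Variables (G M : R).
(** Price of a meeting: the walks then take the same edge with probability [1 / d], and the weight
    exceeds [p^2] by the relative amount [p^-1 - 1]. *)
Let kappa := (p^-1 - 1) / d%:R.
Hypothesis sum_maxprob : forall n, \sum_(i < n) maxprob R d i <= G.
Hypothesis M_ge0 : 0 <= M.
Hypothesis MG : 1 + kappa * G * M <= M.

Let kappa_ge0 : 0 <= kappa.
Proof. by rewrite divr_ge0 // subr_ge0 invf_ge1. Qed.

(** Bounds uniformly the last factor in [sum_pair_weight_le]; this is what allows [M] to stand for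
    everything that follows a common edge. *)
Lemma sum_collide_le n x y :
  1 + kappa * M * \sum_(i < n) collide i x y <= M.
Proof.
apply: le_trans MG; rewrite lerD2l mulrAC ler_wpM2r // ler_wpM2l //.
by apply: le_trans (sum_maxprob n); apply: ler_sum => i _; apply: collide_le.
Qed.

(* A common edge costs a factor [p^-1] relative to two independent edges, and
   after a common edge the two walks start afresh from a common vertex; hence
   the pair weight is dominated by a sum over the time of a meeting. *)
Lemma sum_pair_weight_le n x y :
  \sum_(w <- words 'I_d n) \sum_(w' <- words 'I_d n) pair_weight x y w w' <=
  (p * d%:R) ^+ (2 * n) * (1 + kappa * M * \sum_(i < n) collide i x y).
Proof.
elim: n x y => [|n IHn] x y.
  by rewrite /= !big_seq1 big_ord0 mulr0 addr0 mulr1.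
rewrite big_words2; set E := (p * d%:R) ^+ (2 * n).
have E0 : 0 <= E by rewrite exprn_ge0 // mulr_ge0 // ltW.
set S := fun x y => 1 + kappa * M * \sum_(i < n) collide i x y.
pose wt j j' := if x == y then q j j' else p ^+ 2.
have wt0 j j' : 0 <= wt j j' by rewrite /wt; case: ifP; rewrite ?exprn_ge0 // ltW.
(* Negative correlation: the weight can exceed [p^2] only on the diagonal at a common vertex. *)
have wt_le j j' : wt j j' <= p ^+ 2 + (j == j')%:R * ((x == y)%:R * (p - p ^+ 2)).
  rewrite /wt; case: (eqVneq x y) => _; last by rewrite mul0r mulr0 addr0.
  case: (eqVneq j j') => [<-|/q_off]; last by rewrite mul0r addr0.
  by rewrite q_diag !mul1r addrC subrK.
(* The part [p^2] keeps the induction bound at the new positions, while the diagonal excess uses the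
   uniform bound [M]. *)
apply: le_trans (_ : \sum_j \sum_j' (p ^+ 2 * (E * S (upstep x j) (upstep y j')) +
    (j == j')%:R * ((x == y)%:R * (p - p ^+ 2) * (E * M))) <= _).
  apply: ler_sum => j _; apply: ler_sum => j' _; under eq_bigr do rewrite -big_distrr.
  rewrite -big_distrr /= -/(wt j j').
  apply: le_trans (ler_wpM2l (wt0 j j') (IHn _ _)) _.
  have S0 : 0 <= E * S (upstep x j) (upstep y j').
    apply: mulr_ge0 => //; apply: addr_ge0 => //; apply: mulr_ge0.
      exact: mulr_ge0.
    by apply: sumr_ge0 => i _; apply: collide_ge0.
  apply: le_trans (ler_wpM2r S0 (wt_le j j')) _.
  rewrite mulrDl lerD2l -!mulrA !ler_wpM2l // ?subr_ge0.
    by rewrite expr2 ler_piMr // ltW.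
  exact: sum_collide_le.
under eq_bigr do rewrite big_split /=.
rewrite big_split /=.
under [X in _ + X <= _]eq_bigr do rewrite -big_distrl.
rewrite -[X in _ + X <= _]big_distrl /=.
have -> : \sum_j \sum_(j' < d) (j == j')%:R = d%:R :> R.
  rewrite (eq_bigr (fun=> 1)) ?sumr_const ?card_ord // => j _.
  rewrite (bigD1 j) //= eqxx big1 ?addr0 // => i /negPf.
  by rewrite eq_sym => ->.
have -> : \sum_(j < d) \sum_(j' < d) p ^+ 2 * (E * S (upstep x j) (upstep y j')) =
    p ^+ 2 * (E * (d%:R ^+ 2 * (1 + kappa * M * \sum_(i < n) collide i.+1 x y))).
  have -> : d%:R ^+ 2 * (1 + kappa * M * \sum_(i < n) collide i.+1 x y) =
      \sum_(j < d) \sum_(j' < d) S (upstep x j) (upstep y j').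
    rewrite mulrDr mulr1 mulrCA mulr_sumr.
    under eq_bigr do rewrite collideS.
    rewrite exchange_big mulr_sumr /=.
    transitivity (\sum_(j < d) (d%:R + kappa * M *
        \sum_(j' < d) \sum_(i < n) collide i (upstep x j) (upstep y j'))).
      rewrite big_split /= sumr_const card_ord -[X in _ = X + _]mulr_natl expr2.
      by congr (_ + _); apply: eq_bigr => j _; rewrite exchange_big.
    apply: eq_bigr => j _; rewrite mulr_sumr (_ : d%:R = \sum_(j' < d) 1).
      by rewrite -big_split.
    by rewrite sumr_const card_ord.
  rewrite !mulr_sumr; apply: eq_bigr => j _; by rewrite !mulr_sumr.
(* The diagonal contribution matches the meeting at time 0, because
   [d (p - p^2) = (p d)^2 kappa]. *)
rewrite mulnS exprD big_ord_recl collide0 -/E.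
set s := \sum_(i < n) _; rewrite le_eqVlt; apply/orP; left; apply/eqP.
rewrite /kappa; field.
by rewrite dR0 gt_eqF.
Qed.
End Collisions.

(** * Probabilities of finitely many events and the second moment method *)

Section FiniteEvents.
Variables (R : realType) (d : measure_display) (T : measurableType d).
Variable P : probability T R.

Definition event (e : T -> bool) := measurable [set t | e t].

Definition prob (e : T -> bool) : R := fine (P [set t | e t]).

Lemma eventI e f : event e -> event f -> event (fun t => e t && f t).
Proof.
move=> me mf; rewrite /event (_ : [set t | _] = [set t | e t] `&` [set t | f t]).
  exact: measurableI.
by apply/seteqP; split=> t /= => [/andP|/andP].
Qed.

Lemma eventC e : event e -> event (fun t => ~~ e t).
Proof.
move=> me; rewrite /event (_ : [set t | _] = ~` [set t | e t]).
  exact: measurableC.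
by apply/seteqP; split=> t /= /negP.
Qed.

Lemma event_true : event (fun=> true).
Proof.
rewrite /event (_ : [set t | _] = setT); first exact: measurableT.
by apply/seteqP; split.
Qed.

Lemma event_false : event (fun=> false).
Proof. by apply: eq_ind (eventC event_true) _ _. Qed.

Lemma eventU e f : event e -> event f -> event (fun t => e t || f t).
Proof.
move=> me mf; have := eventC (eventI (eventC me) (eventC mf)).
by congr event; apply/funext => t; rewrite negb_and !negbK.
Qed.

Lemma event_has (J : eqType) (s : seq J) (B : J -> T -> bool) :
  {in s, forall j, event (B j)} -> event (fun t => has (B^~ t) s).
Proof.
elim: s => [|j s IHs] mB; first exact: event_false.
apply: eventU; first by apply: mB; rewrite mem_head.
by apply: IHs => i si; apply: mB; rewrite inE si orbT.
Qed.

Lemma event_all (J : eqType) (s : seq J) (B : J -> T -> bool) :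
  {in s, forall j, event (B j)} -> event (fun t => all (B^~ t) s).
Proof.
elim: s => [|j s IHs] mB; first exact: event_true.
apply: eventI; first by apply: mB; rewrite mem_head.
by apply: IHs => i si; apply: mB; rewrite inE si orbT.
Qed.

Lemma eq_prob e f : e =1 f -> prob e = prob f.
Proof. by move/funext => ->. Qed.

Lemma probE e : event e -> P [set t | e t] = (prob e)%:E.
Proof. by move=> me; rewrite fineK // fin_num_measure. Qed.

Lemma prob_ge0 e : 0 <= prob e.
Proof. exact: fine_ge0. Qed.

Lemma prob_false : prob (fun=> false) = 0.
Proof. by rewrite /prob (_ : [set t | _] = set0) ?measure0 //; apply/seteqP; split. Qed.

Lemma prob_split e f : event e -> event f ->
  prob e = prob (fun t => f t && e t) + prob (fun t => ~~ f t && e t).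
Proof.
move=> me mf; apply: EFin_inj.
rewrite EFinD -!probE //; try by apply: eventI => //; apply: eventC.
rewrite -measureU; [congr (P _) | | | ].
- by apply/seteqP; split=> t /=; [case: (f t) => ->; [left|right]|case=> /andP[]].
- exact: eventI.
- by apply: eventI => //; apply: eventC.
- by apply/seteqP; split=> t //= -[/andP[-> _] /andP[]].
Qed.

(* Positivity of the expectation of a simple function, for which finite
   additivity suffices. *)
Lemma prob_lincomb_ge0 (J : eqType) (s : seq J) (a : J -> R) (B : J -> T -> bool)
    (c : R) (C : T -> bool) :
  event C -> {in s, forall j, event (B j)} ->
  (forall t, C t -> 0 <= c + \sum_(j <- s) a j * (B j t)%:R) ->
  0 <= c * prob C + \sum_(j <- s) a j * prob (fun t => B j t && C t).
Proof.
elim: s c C => [|j s IHs] c C mC mB H.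
  rewrite big_nil addr0; have [[t Ct]|nC] := pselect (exists t, C t).
    by have := H t Ct; rewrite big_nil addr0 => c0; rewrite mulr_ge0 // prob_ge0.
  rewrite (_ : C = fun=> false); last first.
    by apply/funext => t; apply/negP => Ct; apply: nC; exists t.
  by rewrite prob_false mulr0.
have mj : event (B j) by apply: mB; rewrite mem_head.
have ms : {in s, forall i, event (B i)}.
  by move=> i si; apply: mB; rewrite inE si orbT.
(* Splitting on [B j]: where it holds, its coefficient joins the constant; elsewhere it
   disappears. *)
have := IHs (c + a j) _ (eventI mj mC) ms.
have := IHs c _ (eventI (eventC mj) mC) ms.
rewrite big_cons (prob_split mC mj) => h2 h1.
rewrite (eq_big_seq (fun i => a i * prob (fun t => B i t && (B j t && C t)) +
    a i * prob (fun t => B i t && (~~ B j t && C t)))) /=; last first.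
  move=> i si; rewrite -mulrDr; congr (_ * _).
  rewrite (prob_split (eventI (ms i si) mC) mj).
  by congr (_ + _); apply: eq_prob => t; rewrite andbCA.
rewrite big_split /=.
have {}h1 := h1 _; have {}h2 := h2 _.
suff : 0 <= (c + a j) * prob (fun t => B j t && C t) +
    \sum_(i <- s) a i * prob (fun t => B i t && (B j t && C t)) /\
  0 <= c * prob (fun t => ~~ B j t && C t) +
    \sum_(i <- s) a i * prob (fun t => B i t && (~~ B j t && C t)).
  by case; lra.
split; [apply: h1|apply: h2] => t /andP[Bt Ct]; have := H t Ct; rewrite big_cons.
  by rewrite Bt mulr1 addrA.
by rewrite (negPf Bt) mulr0 add0r.
Qed.

(** Exactly one of the indicators of [f t == j] is 1, so [prob_lincomb_ge0] applies with either
    sign. *)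
Lemma prob_partition (J : finType) (f : T -> J) e :
  event e -> (forall j, event (fun t => f t == j)) ->
  prob e = \sum_j prob (fun t => (f t == j) && e t).
Proof.
move=> me mf; apply/eqP; rewrite eq_le; apply/andP; split.
  have := @prob_lincomb_ge0 J (enum J) (fun=> 1) (fun j t => f t == j) (-1) e me.
  rewrite !big_enum mulN1r addrC subr_ge0 /=.
  under eq_bigr do rewrite mul1r; apply=> // t et.
  rewrite big_enum /= (bigD1 (f t)) //= eqxx mulr1 addrA addNr add0r sumr_ge0 //.
have := @prob_lincomb_ge0 J (enum J) (fun=> -1) (fun j t => f t == j) 1 e me.
rewrite !big_enum mul1r /=.
under eq_bigr do rewrite mulN1r; rewrite sumrN subr_ge0. apply=> // t et.
rewrite big_enum /= (bigD1 (f t)) //= eqxx big1 => [|j]; first by rewrite mulr1 addr0 subrr.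
by rewrite eq_sym => /negPf ->; rewrite mulr0.
Qed.

(* With [N] the number of events that occur, [2 a N - (a N)^2] is at most the
   indicator of [N > 0]; the choice [a = 1 / (M m)] gives the bound. *)
Lemma second_moment (J : eqType) (s : seq J) (A : J -> T -> bool) (m M : R) :
  {in s, forall j, event (A j)} -> 0 < m -> 0 < M ->
  \sum_(i <- s) prob (A i) = m ->
  \sum_(i <- s) \sum_(j <- s) prob (fun t => A i t && A j t) <= M * m ^+ 2 ->
  M^-1 <= prob (fun t => has (A^~ t) s).
Proof.
move=> mA m0 M0 first second; set U := fun t => has (A^~ t) s.
have mU : event U by apply: event_has.
pose a : R := (M * m)^-1.
pose s2 := [seq (i, j) | i <- s, j <- s].
(* Encodes the indicator of [U] minus [2 a N] plus [(a N)^2] as one linear combination of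
   indicators: [None] for [U], [inl] for the linear terms, [inr] for the quadratic ones. *)
pose idx : seq (option (J + J * J)) :=
  None :: [seq Some (inl i) | i <- s] ++ [seq Some (inr ij) | ij <- s2].
pose coef (o : option (J + J * J)) : R :=
  match o with None => 1 | Some (inl _) => - (2 * a) | Some (inr _) => a ^+ 2 end.
pose ev (o : option (J + J * J)) t :=
  match o with None => U t | Some (inl i) => A i t
  | Some (inr ij) => A ij.1 t && A ij.2 t end.
have mev : {in idx, forall o, event (ev o)}.
  move=> o; rewrite inE => /predU1P[-> //|].
  rewrite mem_cat => /orP[/mapP[i si ->]|/mapP[ij]]; first exact: mA.
  by case/allpairsP => -[i j] /= [si sj ->] ->; apply: eventI; apply: mA.
have := @prob_lincomb_ge0 _ idx coef ev 0 (fun=> true) event_true mev.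
rewrite mul0r add0r big_cons big_cat !big_map /=.
have prT (e : T -> bool) : prob (fun t => e t && true) = prob e.
  by apply: eq_prob => t; rewrite andbT.
under eq_bigr do rewrite prT; under [X in _ + (_ + X)]eq_bigr do rewrite prT.
rewrite -!mulr_sumr prT first big_allpairs /= mul1r => H.
have {}H : 0 <= prob U + (- (2 * a) * m + a ^+ 2 *
    \sum_(i <- s) \sum_(j <- s) prob (fun t => A i t && A j t)).
  apply: H => t _; rewrite add0r big_cons big_cat !big_map /= -!mulr_sumr big_allpairs.
  set N : R := \sum_(i <- s) (A i t)%:R.
  have -> : \sum_(i <- s) \sum_(j <- s) (A i t && A j t)%:R = N ^+ 2 :> R.
    rewrite expr2 mulr_suml; apply: eq_bigr => i _; rewrite mulr_sumr.
    by apply: eq_bigr => j _; rewrite -natrM mulnb.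
  (* On [U] the combination is the square of [1 - a N]; off [U], [N] vanishes. *)
  case hU: (U t).
    rewrite [X in 0 <= X](_ : _ = (1 - a * N) ^+ 2) ?sqr_ge0 //.
    by rewrite mulr1n; ring.
  suff -> : N = 0 by rewrite !(mulr0, addr0, expr0n).
  rewrite /N big_seq big1 // => i si; case hA: (A i t) => //.
  by move/hasP: hU; case; exists i.
have : a ^+ 2 * \sum_(i <- s) \sum_(j <- s) prob (fun t => A i t && A j t) <= M^-1.
  apply: le_trans (ler_wpM2l (sqr_ge0 a) second) _.
  by rewrite /a le_eqVlt; apply/orP; left; apply/eqP; field; rewrite !gt_eqF.
have am : - (2 * a) * m = - (2 * M^-1) by rewrite /a; field; rewrite !gt_eqF.
rewrite am in H; lra.
Qed.

End FiniteEvents.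

(** * Negative correlation in a uniform [k]-subset *)

Section UniformSubsets.
Variables (R : realType) (I : finType) (k : nat).
Hypothesis k_le : (k <= #|I|)%N.
Hypothesis I_gt1 : (1 < #|I|)%N.

Definition weight (S : {set I}) : R := (#|S| == k)%:R / 'C(#|I|, k)%:R.

Definition cover_prob (A : {set I}) : R := \sum_(S : {set I} | A \subset S) weight S.

Let C0 : 'C(#|I|, k)%:R != 0 :> R.
Proof. by rewrite pnatr_eq0 -lt0n bin_gt0. Qed.

Let N0 : #|I|%:R != 0 :> R.
Proof. by rewrite pnatr_eq0 -lt0n ltnW. Qed.

Lemma sum_weight_sub (B : {set I}) :
  \sum_(S : {set I}) (S \subset B)%:R * weight S = 'C(#|B|, k)%:R / 'C(#|I|, k)%:R.
Proof.
rewrite /weight -cards_draws -sum1_card natr_sum mulr_suml [RHS]big_mkcond /=.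
apply: eq_bigr => S _; rewrite inE; case: (S \subset B) => /=; last by rewrite mul0r.
by case: (#|S| == k); rewrite ?mul0r ?mulr0 ?mul1r.
Qed.

Lemma cover_probE A : cover_prob A = \sum_(S : {set I}) (A \subset S)%:R * weight S.
Proof.
rewrite /cover_prob big_mkcond; apply: eq_bigr => S _.
by case: ifP => _; rewrite (mul1r, mul0r).
Qed.

Lemma cover_prob_ge0 A : 0 <= cover_prob A.
Proof. by apply: sumr_ge0 => S _; apply: divr_ge0. Qed.

Lemma sum_weight : \sum_S weight S = 1.
Proof.
have := sum_weight_sub [set: I]%SET; rewrite cardsT divff // => <-.
by apply: eq_bigr => S _; rewrite finset.subsetT mul1r.
Qed.

Lemma avoid1 (j : I) :
  \sum_(S : {set I}) (S \subset ~: [set j]%SET)%:R * weight S = 1 - k%:R / #|I|%:R.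
Proof.
have := mul_bin_down #|I| k => /(congr1 (fun n => n%:R : R)).
rewrite sum_weight_sub cardsC1 !natrM natrB // => H.
apply: (mulfI N0); rewrite mulrA H mulfK // mulrBr mulr1.
by rewrite mulrCA divff // mulr1.
Qed.

(** With [n] elements the probability is [(1 - k/n) (1 - k/(n-1))], and the second factor is at most
    the first. *)
Lemma avoid2 (j j' : I) : j != j' ->
  \sum_(S : {set I}) (S \subset ~: [set j; j']%SET)%:R * weight S <= (1 - k%:R / #|I|%:R) ^+ 2.
Proof.
move=> jj'; have := mul_bin_down #|I|.-1 k => /(congr1 (fun n => n%:R : R)).
have := avoid1 j; rewrite !sum_weight_sub cardsC1 => x_def.
have -> : #|~: [set j; j']%SET| = #|I|.-1.-1.
  by rewrite cardsCs finset.setCK cards2 jj' subn2.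
rewrite !natrM => y_def; rewrite -x_def expr2 mulrA.
have n1 : (0 < #|I|.-1)%N by rewrite -ltnS prednK // ltnW.
rewrite ler_pM2r ?invr_gt0 ?ltr0n ?bin_gt0 //.
rewrite -(@ler_pM2l _ (#|I|.-1)%:R) ?ltr0n // y_def mulrA ler_wpM2r //.
rewrite x_def -(@ler_pM2l _ #|I|%:R) ?ltr0n 1?ltnW // mulrCA mulrBr mulr1.
rewrite [_ * (k%:R / _)]mulrCA divff // mulr1 -natrB // -!natrM ler_nat.
by move: k_le n1; move: (#|I|) => n; nia.
Qed.

Lemma cover_prob1 (j : I) : cover_prob [set j]%SET = k%:R / #|I|%:R.
Proof.
have -> : cover_prob [set j]%SET = 1 - \sum_(S : {set I}) (S \subset ~: [set j]%SET)%:R * weight S.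
  rewrite cover_probE -[X in _ = X - _]sum_weight -sumrB; apply: eq_bigr => S _.
  rewrite finset.sub1set finset.subsetC finset.sub1set inE.
  by case: (j \in S); rewrite /= ?mul0r ?mul1r ?subr0 ?subrr.
by rewrite avoid1 opprB addrC subrK.
Qed.

(** Inclusion-exclusion carries the negative correlation from avoiding two elements to containing
    both. *)
Lemma cover_prob2 (j j' : I) : j != j' -> cover_prob [set j; j']%SET <= (k%:R / #|I|%:R) ^+ 2.
Proof.
move=> jj'; have -> : cover_prob [set j; j']%SET = 1 -
    \sum_(S : {set I}) (S \subset ~: [set j]%SET)%:R * weight S -
    \sum_(S : {set I}) (S \subset ~: [set j']%SET)%:R * weight S +
    \sum_(S : {set I}) (S \subset ~: [set j; j']%SET)%:R * weight S.
  rewrite cover_probE -[X in _ = X - _ - _ + _]sum_weight -!sumrB -big_split.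
  apply: eq_bigr => S _ /=.
  rewrite finset.setCU finset.subsetI finset.subUset !finset.sub1set.
  rewrite ![S \subset _]finset.subsetC !finset.sub1set !inE.
  by case: (j \in S); case: (j' \in S); rewrite /= ?mul0r ?mul1r; ring.
by have := avoid2 jj'; rewrite !avoid1; lra.
Qed.

End UniformSubsets.

(** * Independence for events that prescribe some of the chosen edges *)

Section Cylinders.
Variables (dim k : nat) (R : realType) (d : measure_display).
Variables (T : measurableType d) (P : probability T R).
Variable omega : zpt dim -> T -> {set 'I_(2 * dim)}.
Hypothesis model : kDnG_model P omega k.

Local Notation I := 'I_(2 * dim).
Local Notation prob := (prob P).
Local Notation weight := (weight R k).
Local Notation cover_prob := (cover_prob R k).

Lemma event_omega v S : event (fun t => omega v t == S).
Proof.
have [mo _ _] := model; rewrite /event (_ : [set t | _] = omega v @^-1` [set S]) //.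
by apply/seteqP; split=> t /= => [/eqP|->].
Qed.

Lemma event_cover v (A : {set I}) : event (fun t => A \subset omega v t).
Proof.
have := @event_has _ T _ [seq S : {set I} <- enum {set I} | A \subset S]
  (fun S t => omega v t == S) (fun S _ => event_omega v S).
congr event; apply/funext => t; apply/hasP/idP => [[S]|At].
  by rewrite mem_filter => /andP[AS _] /eqP ->.
by exists (omega v t); rewrite // mem_filter At mem_enum.
Qed.

Lemma prob_omega v S : prob (fun t => omega v t == S) = weight S.
Proof.
have [_ Po _] := model; rewrite /prob.
rewrite (_ : [set t | _] = omega v @^-1` [set S]); last first.
  by apply/seteqP; split=> t /= => [/eqP|->].
rewrite Po /weight card_ord; case: (#|S| == k); last by rewrite mul0r.
by rewrite mul1r.
Qed.

Lemma prob_all_omega (K : seq (zpt dim * {set I})) : uniq (unzip1 K) ->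
  prob (fun t => all (fun vS => omega vS.1 t == vS.2) K) =
  \prod_(vS <- K) weight vS.2.
Proof.
move=> uK; have [_ _ indep] := model.
(* The assignment read off the list [K], with the empty set as default elsewhere; it agrees with [K]
   because the vertices are distinct. *)
pose Sf v := nth finset.set0 (unzip2 K) (index v (unzip1 K)).
have Sfi vS : vS \in K -> Sf vS.1 = vS.2.
  move=> vSK; have lt_K : (index vS K < size K)%N by rewrite index_mem.
  have e1 : vS.1 = nth vS.1 (unzip1 K) (index vS K) by rewrite (nth_map vS) ?nth_index.
  by rewrite /Sf {1}e1 index_uniq ?size_map // (nth_map vS) ?nth_index.
have /(congr1 fine) := indep _ Sf uK.
rewrite big_map (_ : \big[setI/setT]_(vS <- K) _ =
    [set t | all (fun vS => omega vS.1 t == vS.2) K]); last first.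
  have : {subset K <= K} by [].
  elim: {1 3 4}K => [|vS K' IHK'] sK.
    by rewrite big_nil; apply/seteqP; split.
  rewrite big_cons IHK' => [|x xK]; last by apply: sK; rewrite inE xK orbT.
  rewrite Sfi; last by apply: sK; rewrite mem_head.
  apply/seteqP; split=> t /= => [[-> ->]|/andP[/eqP -> ->]] //.
  by rewrite eqxx.
rewrite -/(prob _) => ->; rewrite big_map.
transitivity (fine (\prod_(vS <- K) (weight vS.2)%:E)%E).
  congr fine; rewrite big_seq [RHS]big_seq; apply: eq_bigr => vS vSK.
  rewrite Sfi // -(prob_omega vS.1) -probE; last exact: event_omega.
  by congr (P _); apply/seteqP; split=> t /= => [->|/eqP].
by rewrite -(big_morph _ (@EFinM R) (erefl _)).
Qed.

Definition contains (c : zpt dim -> {set I}) (vA : zpt dim * {set I}) : bool :=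
  vA.2 \subset c vA.1.

(** The list [K] of fully revealed vertices is there for the induction: partitioning on the value of
    [omega v] moves [v] from [L] to [K]. *)
Lemma prob_cylinder (L K : seq (zpt dim * {set I})) : uniq (unzip1 (L ++ K)) ->
  prob (fun t => all (contains (omega^~ t)) L &&
                 all (fun vS => omega vS.1 t == vS.2) K) =
  \prod_(vA <- L) cover_prob vA.2 * \prod_(vS <- K) weight vS.2.
Proof.
elim: L K => [|[v A] L IHL] K uLK.
  by rewrite big_nil mul1r -prob_all_omega.
have e_ev : event (fun t => all (contains (omega^~ t)) ((v, A) :: L) &&
                 all (fun vS => omega vS.1 t == vS.2) K).
  apply: eventI.
    apply: (event_all (B := fun vA t => contains (omega^~ t) vA)) => vA _.
    exact: event_cover.
  by apply: (event_all (B := fun vS t => omega vS.1 t == vS.2)) => vS _; apply: event_omega.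
rewrite (prob_partition P e_ev (event_omega v)) big_cons /cover_prob.
rewrite !mulr_suml [RHS]big_mkcond /=; apply: eq_bigr => S _.
case: ifP => AS; last first.
  rewrite -[RHS](prob_false P); apply: eq_prob => t; apply/negP.
  by case/andP => /eqP Sv /andP[/andP[]]; rewrite /contains /= Sv AS.
transitivity (prob (fun t => all (contains (omega^~ t)) L &&
                 all (fun vS => omega vS.1 t == vS.2) ((v, S) :: K))).
  apply: eq_prob => t /=; rewrite /contains /=; case: eqP => [->|]; last by rewrite andbF.
  by rewrite AS.
rewrite IHL; last first.
  move: uLK; rewrite /unzip1 !map_cat /= => uLK.
  by rewrite -cat1s uniq_catCA cat1s.
by rewrite big_cons mulrCA mulrA.
Qed.

Lemma prob_all_cover (L : seq (zpt dim * {set I})) : uniq (unzip1 L) ->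
  prob (fun t => all (contains (omega^~ t)) L) =
  \prod_(vA <- L) cover_prob vA.2.
Proof.
move=> uL; have := @prob_cylinder L [::]; rewrite cats0 big_nil mulr1 => <- //.
by apply: eq_prob => t; rewrite andbT.
Qed.

Fixpoint open_path (c : zpt dim -> {set I}) (x : zpt dim) (s : seq I) :=
  if s is i :: s' then (i \in c x) && open_path c (nbr x i) s' else true.

Lemma event_open_path x s : event (fun t => open_path (omega^~ t) x s).
Proof.
elim: s x => [|i s IHs] x; first exact: event_true.
apply: eventI => //; have := event_cover x [set i]%SET.
by congr event; apply/funext => t; rewrite finset.sub1set.
Qed.

End Cylinders.

(** * Pairs of open upward paths in the model *)

Section PathPairs.
Variables (dim k : nat) (R : realType) (d : measure_display).
Variables (T : measurableType d) (P : probability T R).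
Variable omega : zpt dim -> T -> {set 'I_(2 * dim)}.
Hypothesis model : kDnG_model P omega k.
Hypothesis k_le : (k <= 2 * dim)%N.
Hypothesis k_gt0 : (0 < k)%N.

Local Notation I := 'I_(2 * dim).
Local Notation prob := (prob P).

Let dim_gt0 : (0 < dim)%N.
Proof. by move: k_le k_gt0; lia. Qed.

Definition open_up (c : zpt dim -> {set I}) (x : zpt dim) (w : seq 'I_dim) :=
  open_path c x (map (@up dim) w).

(** The two demands at a common vertex are merged into one entry, so that the entries can concern
    distinct vertices and independence applies. *)
Fixpoint constraints (x y : zpt dim) (w w' : seq 'I_dim) : seq (zpt dim * {set I}) :=
  match w, w' with
  | j :: u, j' :: u' =>
      (if x == y then [:: (x, [set up j; up j']%SET)]
       else [:: (x, [set up j]%SET); (y, [set up j']%SET)])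
      ++ constraints (upstep x j) (upstep y j') u u'
  | _, _ => [::]
  end.

Lemma open_up_pair c x y w w' : size w = size w' ->
  open_up c x w && open_up c y w' = all (contains c) (constraints x y w w').
Proof.
elim: w w' x y => [|j w IHw] [|j' w'] x y //= [/IHw IH].
rewrite /open_up /= all_cat -IH andbACA /open_up; congr (_ && _).
case: eqVneq => [<-|_]; rewrite /= /contains /= !andbT.
  by rewrite finset.subUset !finset.sub1set.
by rewrite !finset.sub1set.
Qed.

Definition level (x : zpt dim) : int := \sum_i x i.

Lemma level_upstep x j : level (upstep x j) = level x + 1.
Proof.
rewrite /level /upstep /nbr; under eq_bigr do rewrite ffunE /= ltn_ord.
rewrite big_split /=; congr (_ + _).
rewrite (bigD1 j) //= eqxx big1 ?addr0 // => i.
by rewrite -(inj_eq val_inj) /= => /negPf ->.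
Qed.

Lemma level_constraints x y w w' v : level x = level y ->
  v \in unzip1 (constraints x y w w') -> level x <= level v.
Proof.
elim: w w' x y => [|j w IHw] [|j' w'] x y //= xy.
rewrite /unzip1 map_cat mem_cat => /orP[|/IHw]; last first.
  by rewrite !level_upstep xy => /(_ erefl); apply: le_trans; rewrite lerDl.
by case: ifP => _; rewrite /= !inE; [move=> /eqP ->|case/orP => /eqP ->]; rewrite ?xy.
Qed.

(* Upward paths visit each level once, so the constraints at different times
   concern different vertices. *)
Lemma uniq_constraints x y w w' : level x = level y ->
  uniq (unzip1 (constraints x y w w')).
Proof.
elim: w w' x y => [|j w IHw] [|j' w'] x y //= xy.
have xy1 : level (upstep x j) = level (upstep y j') by rewrite !level_upstep xy.
have notin z : level z = level x ->
    z \notin unzip1 (constraints (upstep x j) (upstep y j') w w').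
  move=> zx; apply/negP => /(level_constraints xy1).
  by rewrite level_upstep zx leNgt ltrDl.
case: ifP => [_|/negbT xy0] /=; first by rewrite notin //= IHw.
by rewrite inE negb_or xy0 !notin //= IHw.
Qed.

Let p : R := k%:R / (2 * dim)%:R.
Let q (j j' : 'I_dim) : R := cover_prob R k [set up j; up j']%SET.

Let p_gt0 : 0 < p.
Proof. by rewrite divr_gt0 // ltr0n // muln_gt0. Qed.

Let card_gt1 : (1 < #|I|)%N.
Proof. by rewrite card_ord; move: dim_gt0; case: (dim) => // n _; rewrite mulnS. Qed.

Let k_le_card : (k <= #|I|)%N.
Proof. by rewrite card_ord. Qed.

Let cover_up (j : 'I_dim) : cover_prob R k [set up j]%SET = p.
Proof. by rewrite cover_prob1 // card_ord. Qed.

Lemma prob_open_up_pair x y w w' : level x = level y -> size w = size w' ->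
  prob (fun t => open_up (omega^~ t) x w && open_up (omega^~ t) y w') =
  pair_weight p q x y w w'.
Proof.
move=> xy ww'.
rewrite (eq_prob P (fun t => open_up_pair (omega^~ t) x y ww')).
rewrite (prob_all_cover model) ?uniq_constraints //.
elim: w w' x y {xy} ww' => [|j w IHw] [|j' w'] x y //=; first by rewrite big_nil.
case=> ww'; rewrite big_cat /= IHw //; congr (_ * _).
case: ifP => _; first by rewrite big_seq1.
by rewrite big_cons big_seq1 /= !cover_up expr2.
Qed.

(** A path is paired with itself; each of its constraints is then on a single edge. *)
Lemma prob_open_up x w : prob (fun t => open_up (omega^~ t) x w) = p ^+ size w.
Proof.
have := @prob_open_up_pair x x w w erefl erefl.
rewrite (eq_prob P (f := fun t => open_up (omega^~ t) x w)) => [->|t]; last exact: andbb.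
elim: w x => //= j w IHw x; rewrite eqxx /q finset.setUid cover_up IHw.
by rewrite exprS.
Qed.

Lemma event_open_up x w : event (fun t => open_up (omega^~ t) x w).
Proof. exact: event_open_path model _ _. Qed.

Lemma prob_has_open_up (G : R) :
  (forall n, \sum_(i < n) maxprob R dim i <= G) -> 0 <= G ->
  (2 / k%:R - 1 / dim%:R) * G < 1 ->
  exists2 c : R, 0 < c & forall n x,
    c <= prob (fun t => has (open_up (omega^~ t) x) (words 'I_dim n)).
Proof.
move=> HG G0 kG; pose kappa := (p^-1 - 1) / dim%:R.
have dimR : dim%:R != 0 :> R by rewrite pnatr_eq0 -lt0n.
have kR : k%:R != 0 :> R by rewrite pnatr_eq0 -lt0n.
have kappaE : kappa = 2 / k%:R - 1 / dim%:R.
  by rewrite /kappa /p natrM; field; rewrite dimR kR.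
(* The solution of [1 + kappa G M = M], positive because [kappa G < 1]. *)
pose M := (1 - kappa * G)^-1.
have kG0 : 0 < 1 - kappa * G by rewrite kappaE subr_gt0.
have M0 : 0 < M by rewrite invr_gt0.
exists M^-1 => [|n x]; first by rewrite invr_gt0.
have p1 : p <= 1 by rewrite ler_pdivrMr ?mul1r ?ler_nat // ltr0n muln_gt0.
pose m := (p * dim%:R) ^+ n.
have m0 : 0 < m by rewrite exprn_gt0 // mulr_gt0 ?ltr0n.
apply: (second_moment (m := m)) => //.
- by move=> w _; apply: event_open_up.
- rewrite (eq_big_seq (fun=> p ^+ n)) => [|w /size_word wn]; last first.
    by rewrite prob_open_up wn.
  rewrite big_const_seq count_predT size_words card_ord iter_addr_0.
  by rewrite -[LHS]mulr_natr natrX -exprMn.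
have MG : 1 + kappa * G * M <= M.
  rewrite le_eqVlt; apply/orP; left; apply/eqP; rewrite /M; field.
  by rewrite gt_eqF.
rewrite (eq_big_seq (fun w => \sum_(w' <- words 'I_dim n) pair_weight p q x x w w')).
  have := sum_pair_weight_le dim_gt0 (p := p) (q := q) _ _ _ p_gt0 p1 HG (ltW M0) MG n x x.
  have h1 j j' : 0 <= q j j' by apply: cover_prob_ge0.
  have h2 j : q j j = p by rewrite /q finset.setUid cover_up.
  have h3 j j' : j != j' -> q j j' <= p ^+ 2.
    move=> jj'; apply: le_trans (cover_prob2 R k_le_card card_gt1 _) _.
      exact: jj'.
    by rewrite card_ord.
  move=> /(_ h1 h2 h3) H; apply: le_trans H _.
  rewrite mulrC mulnC exprM -/m; apply: ler_wpM2r; first by rewrite exprn_ge0 // ltW.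
  exact: (sum_collide_le dim_gt0 p_gt0 p1 HG (ltW M0) MG).
move=> w /size_word wn; apply: eq_big_seq => w' /size_word wn'.
by rewrite prob_open_up_pair // wn wn'.
Qed.

End PathPairs.

(** * Konig's lemma for self-avoiding open paths *)

Lemma mem_words (T : finType) n (w : seq T) : (w \in words T n) = (size w == n).
Proof.
apply/idP/eqP => [/size_word //|<-] {n}.
elim: w => [|j w IHw]; first by rewrite inE.
by apply/allpairsP; exists (j, w); rewrite mem_enum.
Qed.

Section Konig.
Variables (dim : nat) (c : zpt dim -> {set 'I_(2 * dim)}).
Local Notation I := 'I_(2 * dim).
Implicit Types (x : zpt dim) (s u : seq I).

Definition traj x s := x :: scanl (@nbr dim) x s.

Definition saw x s := open_path c x s && uniq (traj x s).

Lemma open_path_cat x s u :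
  open_path c x (s ++ u) = open_path c x s && open_path c (foldl (@nbr dim) x s) u.
Proof. by elim: s x => //= i s IHs x; rewrite IHs andbA. Qed.

Lemma saw_cat x s u : saw x (s ++ u) -> saw x s.
Proof.
rewrite /saw open_path_cat /traj scanl_cat -cat_cons cat_uniq.
by case/andP=> /andP[-> _] /andP[->].
Qed.

(** Only prefixes with self-avoiding continuations of every length are followed; as there are
    finitely many neighbours, such a prefix can always be prolonged by one step. *)
Lemma infinite_saw x : (forall n, has (saw x) (words I n)) ->
  exists p : nat -> zpt dim, [/\ injective p, p 0%N = x &
    forall n, exists2 i, i \in c (p n) & p n.+1 = nbr (p n) i].
Proof.
move=> Hsaw; pose extendable s := forall n, exists2 u, size u = n & saw x (s ++ u).
have ext0 : extendable [::].
  move=> n; have /hasP[s] := Hsaw n.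
  by rewrite mem_words => /eqP; exists s.
(* A default step for the choice function at words that are not extendable. *)
have [i0 _] : exists i0 : I, true.
  by have /hasP[[|i s]] := Hsaw 1%N; rewrite mem_words // => _ _; exists i.
have extS s : exists i, extendable s -> extendable (rcons s i).
  have [es|nes] := pselect (extendable s); last by exists i0.
  apply: contrapT => /forallNP nex.
  have stuck i : exists n, forall u, size u = n -> ~~ saw x (rcons s i ++ u).
    have /not_implyP[_ /existsNP[n nn]] := nex i.
    exists n => u un; apply/negP => su; apply: nn.
    by exists u.
  have [f Hf] := choice stuck.
  (* If each next step [i] failed at length [f i], a continuation longer than all the [f i] would
     contradict the failure of its own first step. *)
  have [u us su] := es (\max_i f i).+1.
  case: u us su => // i u [us]; rewrite -cat_rcons => su.
  have := Hf i (take (f i) u); rewrite size_take_min us.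
  have fi : (f i <= \max_i f i)%N by apply: leq_bigmax.
  move/(_ (minn_idPl fi)) => /negP; apply.
  by apply: (@saw_cat _ _ (drop (f i) u)); rewrite -catA cat_take_drop.
have [f Hf] := choice extS.
pose W n := iter n (fun s => rcons s (f s)) [::].
have ext n : extendable (W n) by elim: n => //= n; apply: Hf.
have sawW n : saw x (W n).
  by have [u] := ext n 0%N => /size0nil ->; rewrite cats0.
pose p n := foldl (@nbr dim) x (W n).
have trajW n : traj x (W n) = mkseq p n.+1.
  elim: n => //= n IHn; rewrite /traj scanl_rcons -rcons_cons -/(traj _ _) IHn.
  by rewrite -mkseqS.
exists p; split => // [m n pmn|n].
  have /andP[_] := sawW (maxn m n); rewrite trajW => /mkseq_uniqP; apply => //.
    by rewrite inE ltnS leq_maxl.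
  by rewrite inE ltnS leq_maxr.
exists (f (W n)); last by rewrite /p /= foldl_rcons.
have /andP[+ _] := sawW n.+1; rewrite /= -cats1 open_path_cat /=.
by case/and3P.
Qed.

Lemma saw_of_path (p : nat -> zpt dim) : injective p ->
  (forall n, exists2 i, i \in c (p n) & p n.+1 = nbr (p n) i) ->
  forall n, has (saw (p 0%N)) (words I n).
Proof.
move=> pinj pstep n.
have step m : exists i, i \in c (p m) /\ p m.+1 = nbr (p m) i.
  by have [i] := pstep m; exists i.
have [f Hf] := choice step.
have H m : open_path c (p m) [seq f i | i <- iota m n] /\
    traj (p m) [seq f i | i <- iota m n] = [seq p i | i <- iota m n.+1].
  elim: n m => //= n IHn m; have [Hc Hp] := Hf m.
  by have [IH1 IH2] := IHn m.+1; rewrite Hc -Hp IH1 /traj /= -Hp -/(traj _ _) IH2.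
apply/hasP; exists [seq f i | i <- iota 0 n]; first by rewrite mem_words size_map size_iota.
have [H1 H2] := H 0%N; rewrite /saw H1 H2 map_inj_uniq //.
exact: iota_uniq.
Qed.

End Konig.

(** * From finite open upward paths to escape to infinity *)

Lemma level_traj dim (x v : zpt dim) (w : seq 'I_dim) :
  v \in traj x (map (@up dim) w) -> level x <= level v.
Proof.
elim: w x => [|j w IHw] x; first by rewrite inE => /eqP ->.
rewrite /traj /= inE => /predU1P[-> //|/IHw].
by apply: le_trans; rewrite level_upstep lerDl.
Qed.

(** The level rises at each step, so upward paths are automatically self-avoiding. *)
Lemma uniq_traj_up dim (x : zpt dim) (w : seq 'I_dim) : uniq (traj x (map (@up dim) w)).
Proof.
elim: w x => //= j w IHw x; apply/andP; split; last exact: IHw.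
by apply/negP => /(@level_traj _ (upstep x j)); rewrite level_upstep leNgt ltrDl.
Qed.

Section Escapes.
Variables (dim k : nat) (R : realType) (d : measure_display).
Variables (T : measurableType d) (P : probability T R).
Variable omega : zpt dim -> T -> {set 'I_(2 * dim)}.
Hypothesis model : kDnG_model P omega k.
Local Notation I := 'I_(2 * dim).

Lemma escapesE : escapes omega =
  \bigcap_n [set t | has (saw (omega^~ t) (origin dim)) (words I n)].
Proof.
apply/seteqP; split=> t /=.
  by case=> p [pinj <- pstep] n _ /=; apply: saw_of_path.
by move=> H; have [n|p Hp] := @infinite_saw _ (omega^~ t) (origin dim); [exact: H|exists p].
Qed.

(** An open upward path is one of the paths counted in [E n], and the events [E n] decrease to the
    escape event, so continuity from above preserves the uniform bound. *)
Lemma prob_escapes_ge (c : R) :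
  (forall n, c <= prob P
    (fun t => has (open_up (omega^~ t) (origin dim)) (words 'I_dim n))) ->
  (c%:E <= P (escapes omega))%E.
Proof.
move=> Hc; pose E n := [set t | has (saw (omega^~ t) (origin dim)) (words I n)].
have mE n : measurable (E n).
  apply: event_has => s _; rewrite /saw; case: (uniq _); last first.
    by have := event_false T; congr event; apply/funext => t; rewrite andbF.
  have := event_open_path model (origin dim) s; congr event.
  by apply/funext => t; rewrite andbT.
have mU n : event (fun t => has (open_up (omega^~ t) (origin dim)) (words 'I_dim n)).
  by apply: event_has => w _; apply: event_open_up model _ _.
have mcap : measurable (\bigcap_n E n) by apply: bigcap_measurable.
have decE : nonincreasing_seq E.
  apply/nonincreasing_seqP => n; apply/subsetPset => t /hasP[s].
  rewrite mem_words => /eqP sn; rewrite -(cat_take_drop n s) => /saw_cat Ht.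
  by apply/hasP; exists (take n s); rewrite // mem_words size_take sn ltnSn.
have Ec n : (c%:E <= P (E n))%E.
  have : (c%:E <= (prob P (fun t =>
      has (open_up (omega^~ t) (origin dim)) (words 'I_dim n)))%:E)%E.
    by rewrite lee_fin.
  move/le_trans; apply; rewrite -probE; last exact: mU.
  apply: le_measure; rewrite ?inE; [exact: mU|exact: mE|move=> t /hasP[w wn ow]].
  apply/hasP; exists (map (@up dim) w); last by rewrite /saw uniq_traj_up andbT.
  by move: wn; rewrite !mem_words size_map.
have cvgE : P (E n) @[n --> \oo] --> P (\bigcap_n E n).
  by apply: nonincreasing_cvg_mu => //; rewrite ltey_eq fin_num_measure.
rewrite escapesE -(cvg_lim _ cvgE) //; apply: lime_ge; first by apply/cvg_ex; eexists; exact: cvgE.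
exact: nearW.
Qed.

End Escapes.

Theorem theorem2p3 (dim k : nat) (R : realType) (d : measure_display)
    (T : measurableType d) (P : probability T R)
    (omega : zpt dim -> T -> {set 'I_(2 * dim)}) :
  (1 <= dim)%N -> (1 <= k <= 2 * dim)%N ->
  ((4 <= dim)%N /\ (4 <= k)%N \/ (5 <= dim)%N /\ k = 3%N) ->
  kDnG_model P omega k ->
  (0 < P (escapes omega))%E.
Proof.
move=> dim_gt0 /andP[k_gt0 k_le] dk model.
have dim4 : (3 < dim)%N by lia.
have [G HG [G0 G4 G5]] := sum_maxprob_bounded R dim4.
have kG : (2 / k%:R - 1 / dim%:R) * G < 1.
  (* For [k >= 4] the factor [2 / k] is at most [1 / 2]; for [k = 3] it is the [2 / 3] of the
     sharper estimate. *)
  case: dk => [[_ k4]|[d5 ->]]; last exact: G5.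
  apply: le_lt_trans G4; rewrite ler_wpM2r // lerD2r.
  have : 4 <= k%:R :> R by rewrite ler_nat.
  by rewrite ler_pdivrMr ?ltr0n //; lra.
have [c c0 Hc] := prob_has_open_up model k_le k_gt0 HG G0 kG.
apply: lt_le_trans (prob_escapes_ge model (fun n => Hc n _)).
by rewrite lte_fin.
Qed.
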